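(* Let $A\in\mathbb{R}^{n\times n}$ be arbitrary and let $S\in\mathbb{C}^{n\times n}$ be any nonsingular matrix. Then, for almost all $T>0$ (with respect to Lebesgue measure), the problem $$\text{minimize } f_T(p)=-\log\det W(p,T)\quad\text{subject to } p\in X_T\cap\Delta_n$$ has a unique optimal solution $p_{\rm VCS}$, the problem $$\text{minimize } \widetilde f_T(p)=-\log\det \widetilde W(p,T)\quad\text{subject to } p\in X_T\cap\Delta_n$$ has a unique optimal solution $\widetilde p_{\rm VCS}$, and these satisfy $$\widetilde p_{\rm VCS}=p_{\rm VCS}.$$
   Context: $n\in\mathbb{N}$; $e_i$ is the $i$th standard basis vector of $\mathbb{R}^n$; $X^\dagger$ denotes the Hermitian (conjugate) transpose; $X\succ O$ means Hermitian positive definite. $\Delta_n:=\{x\in\mathbb{R}^n \mid \sum_{i=1}^n x_i=1,\ x_i\ge 0\}$ is the probability simplex. For $T>0$ and $p\in\mathbb{R}^n$, the finite-time controllability Gramian is $$W(p,T):=\sum_{i=1}^n p_iW_i(T),\qquad W_i(T):=\int_0^T \exp(At)\,e_ie_i^\top\exp(A^\top t)\,\mathrm{d}t.$$ When $p$ has nonnegative entries, with $B(p):=\mathrm{diag}(\sqrt{p_1},\ldots,\sqrt{p_n})$, this equals $\int_0^T\exp(At)B(p)B(p)^\top\exp(A^\top t)\,\mathrm{d}t$. $X_T:=\{p\in\mathbb{R}^n\mid W(p,T)\succ O\}$. Under the state-coordinate change $x=S\tilde x$, put $\tilde A:=S^{-1}AS$ and $\tilde B(p):=S^{-1}B(p)$.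 The corresponding finite-time controllability Gramian is, for $p\in\Delta_n$, $$\widetilde W(p,T):=\int_0^T\exp(\tilde At)\,\tilde B(p)\tilde B(p)^\dagger\exp(\tilde A^\dagger t)\,\mathrm{d}t .$$ *)

(* Defs.v *)
From HB Require Import structures.
From mathcomp Require Import all_boot all_order all_algebra sesquilinear spectral.
From mathcomp Require Import complex.
From mathcomp Require Import all_classical all_reals all_analysis.

Set Implicit Arguments.
Unset Strict Implicit.
Unset Printing Implicit Defensive.

Import Order.TTheory GRing.Theory Num.Theory.
Import numFieldNormedType.Exports.

Local Open Scope classical_set_scope.
Local Open Scope ring_scope.
Local Open Scope complex_scope.
Local Open Scope sesquilinear_scope.

Definition expmx (K : numFieldType) (n : nat) (M : 'M[K]_n) : 'M[K]_n :=
  lim (series (fun k : nat => (k`!%:R)^-1 *: M ^+ k) @ \oo).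

Definition mxintegral (R : realType) (m n : nat) (T : R)
    (F : R -> 'M[R]_(m, n)) : 'M[R]_(m, n) :=
  \matrix_(i, j) (\int[lebesgue_measure]_(t in `[0, T]) (F t i j))%R.

Definition cmxintegral (R : realType) (m n : nat) (T : R)
    (F : R -> 'M[R[i]]_(m, n)) : 'M[R[i]]_(m, n) :=
  \matrix_(i, j)
    ((\int[lebesgue_measure]_(t in `[0, T]) complex.Re (F t i j))%R +i*
     (\int[lebesgue_measure]_(t in `[0, T]) complex.Im (F t i j))%R).

Definition cplxmx (R : realType) (m n : nat) (M : 'M[R]_(m, n)) :
    'M[R[i]]_(m, n) :=
  map_mx (fun x : R => x%:C) M.

(* The order on R[i] is partial: 0 < z says that z is real and positive. *)
Definition posdefmx (R : realType) (n : nat) (M : 'M[R[i]]_n) : Prop :=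
  M \is hermsymmx /\
  forall x : 'cV[R[i]]_n, x != 0 -> 0 < (x^t* *m M *m x) 0 0.

Definition simplex (R : realType) (n : nat) : set 'rV[R]_n :=
  [set p | \sum_(i < n) p 0 i = 1 /\ forall i, 0 <= p 0 i].
Arguments simplex R n : clear implicits.

Definition gramian_i (R : realType) (n : nat) (A : 'M[R]_n) (T : R)
    (i : 'I_n) : 'M[R]_n :=
  mxintegral T (fun t =>
    expmx (t *: A) *m (delta_mx i 0 : 'cV[R]_n) *m (delta_mx i 0 : 'cV[R]_n)^T
    *m expmx (t *: A^T)).

Definition gramian (R : realType) (n : nat) (A : 'M[R]_n) (p : 'rV[R]_n)
    (T : R) : 'M[R]_n :=
  \sum_(i < n) p 0 i *: gramian_i A T i.

Definition feasible_pd (R : realType) (n : nat) (A : 'M[R]_n) (T : R) :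
    set 'rV[R]_n :=
  [set p | posdefmx (cplxmx (gramian A p T))].

Definition input_mx (R : realType) (n : nat) (p : 'rV[R]_n) : 'M[R]_n :=
  diag_mx (map_mx Num.sqrt p).

(* Gramian in the coordinates x = S x~; it is meaningful for entrywise
   nonnegative p only, since Num.sqrt is 0 on negative reals. *)
Definition gramian_tilde (R : realType) (n : nat) (A : 'M[R]_n)
    (S : 'M[R[i]]_n) (p : 'rV[R]_n) (T : R) : 'M[R[i]]_n :=
  let At := invmx S *m cplxmx A *m S in
  let Bt := invmx S *m cplxmx (input_mx p) in
  cmxintegral T (fun t =>
    expmx (t%:C *: At) *m Bt *m Bt^t* *m expmx (t%:C *: At^t*)).

Definition vcs_objective (R : realType) (n : nat) (A : 'M[R]_n) (T : R)
    (p : 'rV[R]_n) : R :=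
  - ln (\det (gramian A p T)).

(* gramian_tilde is Hermitian, so its determinant is real and taking the real
   part only changes the type. *)
Definition vcs_objective_tilde (R : realType) (n : nat) (A : 'M[R]_n)
    (S : 'M[R[i]]_n) (T : R) (p : 'rV[R]_n) : R :=
  - ln (complex.Re (\det (gramian_tilde A S p T))).

Definition minimizer (R : realType) (V : Type) (f : V -> R) (D : set V) :
    set V :=
  [set p | D p /\ forall q, D q -> f p <= f q].

(* Main.v *)
(** For p in the simplex, W~(p,T) = S^-1 W(p,T) S^-dagger, because
    exp(t S^-1 A S) = S^-1 exp(tA) S. Hence det W~ is det W times the positive
    constant |det S^-1|^2, the two objectives differ by an additive constant on
    the feasible set, and they have the same minimizers.

    Existence: det W(., T) is continuous on the compact simplex and positive at
    its barycenter, so it attains a positive maximum; a positive semidefinite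
    matrix with nonzero determinant is definite, so the maximizer is feasible.

    Uniqueness: -log det is strictly convex on positive definite matrices, so it
    suffices that p |-> W(p,T) be injective. This holds as soon as the matrix
    D(T) of the diagonals of the W_i(T) is nonsingular. The entries of D are
    antiderivatives of squares of entries of exp(tA), so det D solves on
    ]0, +oo[ a linear differential equation with constant coefficients, and
    det D(T) / T^n tends to 1 as T tends to 0. A nonzero solution of such an
    equation has a null zero set: at each zero some iterated derivative does not
    vanish, since otherwise the solution would be zero; and the zeros of a
    function at which its derivative does not vanish are isolated, hence
    countable. *)
Require Import Defs.
From HB Require Import structures.
From mathcomp Require Import all_boot all_order all_algebra sesquilinear spectral.
From mathcomp Require Import complex ring lra.
From mathcomp Require Import all_classical all_reals all_analysis.
Import Order.TTheory GRing.Theory Num.Theory.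
Import numFieldNormedType.Exports.
Local Open Scope classical_set_scope.
Local Open Scope ring_scope.

Set Implicit Arguments.
Unset Strict Implicit.
Unset Printing Implicit Defensive.

(** * The matrix exponential *)

(** A matrix has finitely many entries and a filter is stable under finite intersections. *)
Lemma cvg_mxP (K : numFieldType) (T : Type) (F : set_system T) {FF : Filter F}
    (m n : nat) (u : T -> 'M[K]_(m, n)) (M : 'M[K]_(m, n)) :
  u x @[x --> F] --> M <-> forall i j, u x i j @[x --> F] --> M i j.
Proof.
split=> [uM i j|uM].
  exact: (cvg_comp _ _ uM (@coord_continuous K m n i j M)).
apply/cvg_mx_entourageP => B entB.
suff: \forall x \near F, forall i j, (M i j, u x i j) \in B by [].
apply: filter_forall => i; apply: filter_forall => j.
have : \forall x \near F, B (M i j, u x i j).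
  by move/cvg_entourageP : (uM i j); exact.
by apply: filterS => x Bx; rewrite inE.
Qed.

Lemma cvg_sum (K : numFieldType) (T I : Type) (F : set_system T) {FF : Filter F}
    (r : seq I) (P : pred I) (f : I -> T -> K) (l : I -> K) :
  (forall i, P i -> f i x @[x --> F] --> l i) ->
  \sum_(i <- r | P i) f i x @[x --> F] --> \sum_(i <- r | P i) l i.
Proof. by apply: cvg_big => //; exact: add_continuous. Qed.

Lemma cvg_prod (K : numFieldType) (T I : Type) (F : set_system T)
    {FF : Filter F} (r : seq I) (P : pred I) (f : I -> T -> K) (l : I -> K) :
  (forall i, P i -> f i x @[x --> F] --> l i) ->
  \prod_(i <- r | P i) f i x @[x --> F] --> \prod_(i <- r | P i) l i.
Proof. by apply: cvg_big => //; exact: mul_continuous. Qed.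

Lemma cvg_mulmx (K : numFieldType) (T : Type) (F : set_system T)
    {FF : Filter F} (m n p : nat) (u : T -> 'M[K]_(m, n)) (v : T -> 'M[K]_(n, p))
    (M : 'M[K]_(m, n)) (N : 'M[K]_(n, p)) :
  u x @[x --> F] --> M -> v x @[x --> F] --> N ->
  u x *m v x @[x --> F] --> M *m N.
Proof.
move=> /cvg_mxP uM /cvg_mxP vN; apply/cvg_mxP => i j.
rewrite mxE; under eq_cvg do rewrite mxE.
by apply: cvg_sum => k _; apply: cvgM; [exact: uM|exact: vN].
Qed.

Lemma cvg_det (K : numFieldType) (T : Type) (F : set_system T)
    {FF : Filter F} (n : nat) (u : T -> 'M[K]_n) (M : 'M[K]_n) :
  u x @[x --> F] --> M -> \det (u x) @[x --> F] --> \det M.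
Proof.
move=> /cvg_mxP uM; rewrite /determinant.
apply: cvg_sum => s _; apply: cvgM; first exact: cvg_cst.
by apply: cvg_prod => i _; exact: uM.
Qed.

(* [exprZn] only covers matrices of manifestly positive size. *)
Lemma scalemxX (K : comPzRingType) (n : nat) (c : K) (A : 'M[K]_n) k :
  (c *: A) ^+ k = c ^+ k *: A ^+ k.
Proof.
elim: k => [|k IHk]; first by rewrite !expr0 scale1r.
rewrite exprS IHk [LHS](_ : _ = (c *: A) *m (c ^+ k *: A ^+ k))//.
by rewrite -scalemxAl -scalemxAr scalerA -exprS [A ^+ k.+1]exprS.
Qed.

(** * Power series dominated by an exponential series *)

Section FactorialBound.
Context {R : realType}.
Implicit Types (f : nat -> R) (C c x : R).

(** The majorant is the coefficient sequence of [C * exp (c x)]. The class is stable under formal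
    differentiation and gives convergence on the whole line. *)
Definition factorially_bounded C c f :=
  forall k, `|f k| <= C * (c ^+ k / k`!%:R).

Lemma cvg_pseries_factorial C c f x :
  factorially_bounded C c f -> cvgn (pseries f x).
Proof.
move=> fb; have le_fx k : `|f k| * `|x| ^+ k <= C * exp_coeff (c * `|x|) k.
  rewrite /exp_coeff /= exprMn [X in C * X]mulrAC mulrA ler_wpM2r ?exprn_ge0//.
apply: normed_cvg.
apply: (@series_le_cvg _ _ (fun k => C * exp_coeff (c * `|x|) k)) => [k|k|k|].
- exact: normr_ge0.
- exact: le_trans (le_fx k).
- by rewrite /= normrM normrX; exact: le_fx.
- exact/is_cvg_seriesZ/is_cvg_series_exp_coeff.
Qed.

Lemma factorially_bounded_diffs C c f :
  factorially_bounded C c f ->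
  factorially_bounded (C * c) c (pseries_diffs f).
Proof.
move=> fb k; rewrite /pseries_diffs normrM normr_nat.
have k1 : 0 < k.+1%:R :> R by rewrite ltr0n.
rewrite -ler_pdivlMl//; apply: le_trans (fb k.+1) _.
rewrite le_eqVlt; apply/orP; left; apply/eqP.
by rewrite factS natrM exprS invfM; ring.
Qed.

Lemma is_derive_pseries C c f x : factorially_bounded C c f ->
  is_derive x (1 : R) (fun y => limn (pseries f y))
    (limn (pseries (pseries_diffs f) x)).
Proof.
move=> fb; have fb1 := factorially_bounded_diffs fb.
have fb2 := factorially_bounded_diffs fb1.
(* Termwise differentiation at [x] asks for convergence of the series and of its first two formal
   derivatives at some point beyond [|x|]. *)
apply: (@pseries_snd_diffs _ _ (`|x| + 1)).
- exact: cvg_pseries_factorial fb.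
- exact: cvg_pseries_factorial fb1.
- exact: cvg_pseries_factorial fb2.
- by rewrite [ltRHS]ger0_norm ?addr_ge0// ltrDl.
Qed.

End FactorialBound.

(** * The real matrix exponential *)

Section RealExponential.
Context {R : realType} {n : nat}.
Implicit Types (A : 'M[R]_n) (t : R).

Definition expmx_coef A (i j : 'I_n) (k : nat) : R := k`!%:R^-1 * (A ^+ k) i j.

(** The sum [c] of the absolute values of all entries dominates every absolute row sum, so induction
    on [k] bounds each entry of [A ^+ k] by [c ^+ k]. *)
Lemma factorially_bounded_expmx_coef A i j :
  factorially_bounded 1 (\sum_(l < n) \sum_(m < n) `|A l m|)
    (expmx_coef A i j).
Proof.
set c := \sum_(l < n) _; move=> k; rewrite /expmx_coef mul1r mulrC.
have cge0 : 0 <= c by apply: sumr_ge0 => l _; exact: sumr_ge0.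
rewrite normrM [X in _ * X]ger0_norm ?invr_ge0// ler_wpM2r ?invr_ge0//.
elim: k i j => [|k IHk] i j.
  by rewrite !expr0 mxE; case: eqP => _; rewrite ?normr1 ?normr0.
rewrite !exprS mxE (le_trans (ler_norm_sum _ _ _))//.
apply: (@le_trans _ _ (\sum_l `|A i l| * c ^+ k)).
  by apply: ler_sum => l _; rewrite normrM ler_wpM2l.
rewrite -mulr_suml ler_wpM2r ?exprn_ge0//.
by rewrite /c [leRHS](bigD1 i)//= lerDl; do 2![apply: sumr_ge0 => ? _].
Qed.

Lemma series_expmxE A t i j k :
  series (fun k => k`!%:R^-1 *: (t *: A) ^+ k) k i j =
  pseries (expmx_coef A i j) t k.
Proof.
rewrite /series /pseries /= summxE; apply: eq_bigr => l _.
by rewrite scalemxX !mxE /expmx_coef mulrCA mulrC.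
Qed.

Lemma cvg_expmx A t :
  series (fun k => k`!%:R^-1 *: (t *: A) ^+ k) @ \oo --> expmx (t *: A).
Proof.
suff : cvg (series (fun k => k`!%:R^-1 *: (t *: A) ^+ k) @ \oo) by [].
apply/cvg_ex; exists (\matrix_(i, j) limn (pseries (expmx_coef A i j) t)).
apply/cvg_mxP => i j; rewrite mxE; under eq_cvg do rewrite series_expmxE.
exact: cvg_pseries_factorial (factorially_bounded_expmx_coef A i j).
Qed.

Lemma expmxE A t i j : expmx (t *: A) i j = limn (pseries (expmx_coef A i j) t).
Proof.
apply/esym/cvg_lim => //.
have /cvg_mxP/(_ i j) := @cvg_expmx A t.
by under eq_cvg do rewrite series_expmxE.
Qed.

Lemma expmx0 A : expmx (0 *: A) = 1%:M.
Proof.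
apply: (cvg_lim (@norm_hausdorff _ _)).
apply: cvg_near_cst; exists 1%N => // k /= k1.
rewrite scale0r /series /= big_ltn// fact0 expr0 invr1 scale1r.
by rewrite big_nat_cond big1 ?addr0// => -[|l]//; rewrite expr0n/= scaler0.
Qed.

(** The formal derivative has coefficients [(A ^+ k.+1) i j / k!]; splitting off one factor [A] on
    the left turns them into the row [i] of [A] applied to the coefficients of the column [j]. *)
Lemma derive_expmx A t i j :
  is_derive t (1 : R) (fun s => expmx (s *: A) i j) ((A *m expmx (t *: A)) i j).
Proof.
rewrite (_ : (fun s => _) = (fun s => limn (pseries (expmx_coef A i j) s))).
  apply: (is_derive_eq (is_derive_pseries t (factorially_bounded_expmx_coef A i j))).
  rewrite mxE; apply: cvg_lim => //.
  rewrite (_ : pseries _ t =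
      (fun k => \sum_l A i l * pseries (expmx_coef A l j) t k)).
    apply: cvg_sum => l _; apply: cvgM; first exact: cvg_cst.
    rewrite expmxE.
    exact: cvg_pseries_factorial (factorially_bounded_expmx_coef A l j).
  apply/funext => k; rewrite /pseries /series /=.
  under [RHS]eq_bigr do rewrite mulr_sumr.
  rewrite exchange_big /=; apply: eq_bigr => l _.
  rewrite /pseries_diffs /expmx_coef factS natrM invfM mulrA mulVKf//.
  rewrite exprS mxE mulr_sumr mulr_suml; apply: eq_bigr => m _.
  by rewrite !mulrA [_ * A i m]mulrC.
by apply/funext => s; rewrite expmxE.
Qed.

Lemma trmxX A k : (A ^+ k)^T = A^T ^+ k.
Proof. by elim: k => [|k IHk]; rewrite ?trmx1// exprS exprSr trmx_mul IHk. Qed.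

Lemma expmx_tr A t : expmx (t *: A^T) = (expmx (t *: A))^T.
Proof.
apply/matrixP => i j; rewrite mxE !expmxE; congr (limn (pseries _ t)).
by apply/funext => k; rewrite /expmx_coef -trmxX mxE.
Qed.

(** [A] commutes with every partial sum, so both sides are limits of one sequence. *)
Lemma comm_expmx A t : A *m expmx (t *: A) = expmx (t *: A) *m A.
Proof.
apply: (@cvg_unique _ (@norm_hausdorff _ 'M[R]_n)
    ((fun k => A *m series (fun k => k`!%:R^-1 *: (t *: A) ^+ k) k) @ \oo)).
  by apply: cvg_mulmx; [exact: cvg_cst|exact: cvg_expmx].
rewrite (_ : (fun k => A *m _) =
  (fun k => series (fun k => k`!%:R^-1 *: (t *: A) ^+ k) k *m A)); last first.
  apply/funext => k; rewrite /series /= mulmx_sumr mulmx_suml.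
  apply: eq_bigr => l _; rewrite scalemxX -!(scalemxAl, scalemxAr).
  by do 2 congr (_ *: _); rewrite -[LHS]exprS exprSr.
by apply: cvg_mulmx; [exact: cvg_expmx|exact: cvg_cst].
Qed.

Lemma continuous_expmx A i j : continuous (fun t => expmx (t *: A) i j).
Proof.
move=> t; apply/differentiable_continuous/derivable1_diffP.
by case: (derive_expmx A t i j).
Qed.

End RealExponential.

(** * Complexification and similarity *)

Section ComplexExponential.
Context {R : realType} {n : nat}.
Local Open Scope complex_scope.

Lemma cvg_cplxmx (T : Type) (F : set_system T) {FF : Filter F} (m p : nat)
    (u : T -> 'M[R]_(m, p)) (M : 'M[R]_(m, p)) :
  u x @[x --> F] --> M ->
  (cplxmx (u x) : 'M[(R[i] : numFieldType)]_(m, p)) @[x --> F] -->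
  (cplxmx M : 'M[(R[i] : numFieldType)]_(m, p)).
Proof.
move=> /cvg_mxP uM; apply/cvg_mxP => i j; rewrite mxE.
under eq_cvg do rewrite mxE.
have /cvgrPdist_lt uMij := uM i j; apply/cvgrPdist_lt => -[e ei].
(* A positive element of [R[i]] is real, so a real radius suffices. *)
rewrite ltcE /= => /andP[/eqP -> e0].
apply: filterS (uMij e e0) => x; rewrite -rmorphB normc_def /=.
by rewrite expr0n /= addr0 sqrtr_sqr ltcR.
Qed.

Lemma cplxmxM (m p q : nat) (M : 'M[R]_(m, p)) (N : 'M[R]_(p, q)) :
  cplxmx (M *m N) = cplxmx M *m cplxmx N.
Proof. exact: map_mxM. Qed.

Lemma cplxmxX (A : 'M[R]_n) k : cplxmx (A ^+ k) = cplxmx A ^+ k.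
Proof.
elim: k => [|k IHk]; first exact: map_mx1.
by rewrite !exprS [LHS]cplxmxM IHk.
Qed.

(** Since [Q *m P = 1], inner factors cancel in the powers of [P A Q], hence in the partial sums. A
    pair [P], [Q] covers both the similarity by [S] and its adjoint. *)
Lemma expmx_similar (A : 'M[R]_n) (P Q : 'M[R[i]]_n) (t : R) :
  Q *m P = 1%:M ->
  expmx (t%:C *: (P *m cplxmx A *m Q)) = P *m cplxmx (expmx (t *: A)) *m Q.
Proof.
move=> QP; have PQ : P *m Q = 1%:M by exact: mulmx1C.
apply: (cvg_lim (@norm_hausdorff _ _)).
rewrite (_ : series _ = (fun k => P *m
    cplxmx (series (fun k => k`!%:R^-1 *: (t *: A) ^+ k) k) *m Q)).
  apply: cvg_mulmx; last exact: cvg_cst.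
  apply: cvg_mulmx; first exact: cvg_cst.
  exact: cvg_cplxmx (@cvg_expmx R n A t).
apply/funext => k; rewrite /series /= /cplxmx raddf_sum/=.
rewrite mulmx_sumr mulmx_suml; apply: eq_bigr => l _.
have powE m : (P *m cplxmx A *m Q) ^+ m = P *m cplxmx A ^+ m *m Q.
  elim: m => [|m IHm]; first by rewrite !expr0 mulmx1 PQ.
  rewrite !exprSr [LHS](_ : _ = (P *m cplxmx A *m Q) ^+ m *m (P *m cplxmx A *m Q))//.
  rewrite IHm -!mulmxA; congr (_ *m _). rewrite !mulmxA.
  by rewrite -[_ *m Q *m P]mulmxA QP mulmx1.
rewrite !scalemxX powE !map_mxZ /= -[map_mx _ _]/(cplxmx (A ^+ l)) cplxmxX.
by rewrite -!scalemxAr -!scalemxAl fmorphV rmorph_nat rmorphXn.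
Qed.

End ComplexExponential.

(** * Zeros of solutions of linear differential equations *)

Section DerivableFunctions.
Context {R : realType}.
Implicit Types (f g : R -> R) (t : R).

Lemma is_derive_bigsum (I : Type) (r : seq I) (f : I -> R -> R) (df : I -> R) t :
  (forall i, is_derive t (1 : R) (f i) (df i)) ->
  is_derive t (1 : R) (fun s => \sum_(i <- r) f i s) (\sum_(i <- r) df i).
Proof.
move=> fd; elim: r => [|i r IHr].
  rewrite big_nil (_ : (fun s => _) = cst 0); first exact: is_derive_cst.
  by apply/funext => s; rewrite big_nil.
rewrite big_cons (_ : (fun s => _) = f i + (fun s => \sum_(i <- r) f i s)).
  exact: is_deriveD.
by apply/funext => s; rewrite big_cons.
Qed.

Lemma is_derive_mul f g (df dg t : R) :
  is_derive t (1 : R) f df -> is_derive t (1 : R) g dg ->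
  is_derive t (1 : R) (fun s => f s * g s) (df * g t + f t * dg).
Proof.
move=> fd gd; apply: (is_derive_eq (is_deriveM fd gd)).
by rewrite addrC; congr (_ + _); rewrite ?[_ *: _]mulrC.
Qed.

Lemma is_derive0_cst f :
  (forall t : R, 0 < t -> is_derive t (1 : R) f 0) ->
  forall s t, 0 < s -> 0 < t -> f s = f t.
Proof.
move=> fd s t s0 t0; wlog st : s t s0 t0 / s <= t.
  move=> H; have [|/ltW ts] := leP s t; first exact: H.
  by apply/esym/H.
have [c _] : exists2 c, c \in `[s, t] & f t - f s = 0 * (t - s).
  apply: (@MVT_segment _ f (fun=> 0)) => // [x|].
    by rewrite in_itv/= => /andP[sx _]; apply/fd/(lt_trans s0).
  apply: derivable_within_continuous => x; rewrite in_itv/= => /andP[sx _].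
  by case: (fd x (lt_le_trans s0 sx)).
by rewrite mul0r => /eqP; rewrite subr_eq0 => /eqP.
Qed.

(* A zero at which the derivative does not vanish is isolated. *)
Lemma simple_zeros_negligible f (df : R -> R) :
  (forall t : R, 0 < t -> is_derive t (1 : R) f (df t)) ->
  lebesgue_measure.-negligible [set t | [/\ 0 < t, f t = 0 & df t != 0]].
Proof.
move=> fd; set Z := [set t | _].
have isolated t : Z t -> exists2 e : R, 0 < e &
    forall s, `|s - t| < e -> Z s -> s = t.
  move=> [t0 ft0 dft]; have [/cvg_ex[l fl] dfE] := fd t t0.
  have lE : l = df t by rewrite -dfE; apply/esym; exact: cvg_lim fl.
  (* Difference quotients close to a nonzero derivative are nonzero, whereas one taken between two
     zeros vanishes. *)
  have : \forall h \near 0^', h^-1 *: (f (h *: 1 + t) - f t) != 0.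
    rewrite lE in fl.
    have /cvgrPdist_lt/(_ `|df t|) := fl; rewrite normr_gt0 => /(_ dft).
    by apply: filterS => h; apply: contraTneq => ->; rewrite subr0 ltxx.
  move=> /nbhs_ballP[e /= e0 eP].
  exists e => // s st [_ fs0 _]; apply/eqP; rewrite -subr_eq0; apply/negPn/negP.
  move=> st0; have := eP (s - t); rewrite /ball /= sub0r normrN => /(_ st st0).
  by rewrite [_ *: 1]mulr1 subrK fs0 ft0 subrr scaler0 eqxx.
have cZ : countable Z.
  (* An isolated point of [Z] is alone in some interval with rational end points; each [B q] has at
     most one element. *)
  pose B (q : rat * rat) := [set t | [/\ Z t, ratr q.1 < t < ratr q.2 &
    forall s, Z s -> ratr q.1 < s < ratr q.2 -> s = t]].
  have ZB : Z `<=` \bigcup_q B q.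
    move=> t Zt; have [e e0 eP] := isolated t Zt.
    have [p] := @rat_in_itvoo R (t - e) t ltac:(by rewrite ltrBlDr ltrDl).
    rewrite in_itv/= => /andP[tep pt].
    have [q] := @rat_in_itvoo R t (t + e) ltac:(by rewrite ltrDl).
    rewrite in_itv/= => /andP[tq qte].
    exists (p, q) => //; split=> //=; first by rewrite pt.
    move=> s Zs /andP[ps sq]; apply: eP => //.
    by rewrite ltr_distl (lt_trans tep ps) (lt_trans sq qte).
  apply: (sub_countable (subset_card_le ZB)).
  apply: bigcup_countable => // q _.
  have [[t Bt]|B0] := pselect (exists t, B q t).
    apply: (@sub_countable _ _ _ [set t]); last exact: countable1.
    apply: subset_card_le => s [Zs qs _] /=.
    by case: Bt => _ _; apply.
  rewrite (_ : B q = set0); first exact: countable0.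
  by apply/seteqP; split=> // t Bt; apply: B0; exists t.
exists Z; split=> //.
  by apply: countable_measurable => // t; exact: measurable_set1.
exact: countable_lebesgue_measure0.
Qed.

End DerivableFunctions.

(** * Linear systems with constant coefficients *)

Section LinearSystem.
Context {R : realType} {m : nat}.
Context (N : 'M[R]_m) (F : R -> 'cV[R]_m).
Context (dF : forall t : R, 0 < t ->
  forall i, is_derive t (1 : R) (fun s => F s i 0) ((N *m F t) i 0)).

(** The function [G r = exp((t - r) N) F r] has zero derivative; its values at [r = t] and [r = s]
    are the two sides. *)
Lemma linear_system_solution (s t : R) : 0 < s -> 0 < t ->
  F t = expmx ((t - s) *: N) *m F s.
Proof.
move=> s0 t0; pose G r := expmx ((t - r) *: N) *m F r.
have dG i (r : R) : 0 < r -> is_derive r (1 : R) (fun r => G r i 0) 0.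
  move=> r0.
  have -> : (fun r => G r i 0) =
      (fun r => \sum_j expmx ((t - r) *: N) i j * F r j 0).
    by apply/funext => x; rewrite /G mxE.
  have dE j : is_derive r (1 : R) (fun r => expmx ((t - r) *: N) i j)
      (- (expmx ((t - r) *: N) *m N) i j).
    rewrite -comm_expmx -mulrN1.
    apply: (@is_derive1_comp _ (fun u => expmx (u *: N) i j) (fun r => t - r)).
      exact: derive_expmx.
    apply: (is_derive_eq (is_deriveB (is_derive_cst t r 1) (is_derive_id r 1))).
    by rewrite sub0r.
  apply: (is_derive_eq (is_derive_bigsum _
    (fun j => is_derive_mul (dE j) (dF r0 j)))).
  rewrite big_split /=.
  under eq_bigr do rewrite mulNr.
  rewrite sumrN.
  have -> : \sum_j (expmx ((t - r) *: N) *m N) i j * F r j 0 =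
    (expmx ((t - r) *: N) *m N *m F r) i 0 by rewrite [RHS]mxE.
  have -> : \sum_j expmx ((t - r) *: N) i j * (N *m F r) j 0 =
    (expmx ((t - r) *: N) *m (N *m F r)) i 0 by rewrite [RHS]mxE.
  by rewrite mulmxA addNr.
apply/matrixP => i j; rewrite (ord1 j) -[RHS]/(G s i 0).
rewrite (is_derive0_cst (dG i) s0 t0) /G subrr expmx0.
by rewrite mul1mx.
Qed.

(** The numbers [c N^k F(t0)] are the iterated derivatives of [c F] at [t0], and [c F(t)] is the sum
    of the resulting Taylor series. *)
Lemma linear_system_vanish (c : 'rV[R]_m) (t0 : R) : 0 < t0 ->
  (forall k, (c *m N ^+ k *m F t0) 0 0 = 0) ->
  forall t, 0 < t -> (c *m F t) 0 0 = 0.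
Proof.
move=> t00 c0 t tgt0; rewrite (linear_system_solution t00 tgt0) mulmxA.
set s := t - t0.
have : (c *m series (fun k => k`!%:R^-1 *: (s *: N) ^+ k) k *m F t0)
    @[k --> \oo] --> c *m expmx (s *: N) *m F t0.
  apply: cvg_mulmx; last exact: cvg_cst.
  by apply: cvg_mulmx; [exact: cvg_cst|exact: cvg_expmx].
move=> /cvg_mxP/(_ 0 0) h; apply/esym; apply: cvg_unique h => //.
rewrite (_ : (fun k => _) = cst 0); first exact: cvg_cst.
apply/funext => k; rewrite /series /= mulmx_sumr mulmx_suml summxE big1// => l _.
by rewrite scalemxX -!scalemxAr -!scalemxAl mxE [X in _ * X]mxE c0 !mulr0.
Qed.

Lemma linear_system_zeros_negligible (c : 'rV[R]_m) (t1 : R) :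
  0 < t1 -> (c *m F t1) 0 0 != 0 ->
  lebesgue_measure.-negligible [set t | 0 < t /\ (c *m F t) 0 0 = 0].
Proof.
move=> t10 ct1; pose u k t := (c *m N ^+ k *m F t) 0 0.
have du k (t : R) : 0 < t -> is_derive t (1 : R) (u k) (u k.+1 t).
  move=> tgt0; have -> : u k = (fun t => \sum_j (c *m N ^+ k) 0 j * F t j 0).
    by apply/funext => x; rewrite /u mxE.
  apply: (is_derive_eq (is_derive_bigsum _ (fun j => is_derive_mul
    (is_derive_cst ((c *m N ^+ k) 0 j) t 1) (dF tgt0 j)))).
  rewrite /u exprSr mulmxA -mulmxA [RHS]mxE.
  by apply: eq_bigr => j _; rewrite mul0r add0r.
have neg : lebesgue_measure.-negligible
    (\bigcup_k [set t | [/\ 0 < t, u k t = 0 & u k.+1 t != 0]]).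
  by apply: negligible_bigcup => k; exact: simple_zeros_negligible (du k).
apply: negligibleS neg.
move=> t [tgt0 ct].
have /existsNP[k uk] : ~ forall k, u k t = 0.
  by move=> /(linear_system_vanish tgt0)/(_ _ t10)/eqP; apply/negP.
have ex_k : exists k, u k t != 0 by exists k; apply/eqP.
(* The least order of a nonvanishing derivative is positive because [t] is a zero; if it is [l.+1],
   then [t] is a simple zero of [u l]. *)
case: (ex_minnP ex_k) => -[|l] ul minl.
  by move: ul; rewrite /u expr0 mulmx1 ct eqxx.
exists l => //; split=> //; apply/eqP/negPn/negP => /minl.
by rewrite ltnn.
Qed.

End LinearSystem.

(** * Closure properties of exponential polynomials *)

Section LinearODE.
Context {R : realType}.
Implicit Types (f g : R -> R).

(* The linear span of the components of a solution on ]0, +oo[ of some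
   constant-coefficient linear system; these are the exponential polynomials. *)
Definition lin_ode f : Prop :=
  exists (I : finType) (F : I -> R -> R) (N : I -> I -> R) (c : I -> R),
    (forall t : R, 0 < t -> forall i,
       is_derive t (1 : R) (F i) (\sum_j N i j * F j t)) /\
    (forall t : R, 0 < t -> f t = \sum_i c i * F i t).

Lemma lin_ode_ext f g : (forall t : R, 0 < t -> f t = g t) -> lin_ode f -> lin_ode g.
Proof.
move=> fg [I [F [N [c [dF fE]]]]]; exists I, F, N, c; split=> // t t0.
by rewrite -fg // fE.
Qed.

Lemma lin_ode_cst a : lin_ode (fun=> a).
Proof.
exists unit, (fun _ _ => 1), (fun _ _ => 0), (fun=> a); split=> t t0.
  move=> i; rewrite big1; first exact: is_derive_cst.
  by move=> *; rewrite mul0r.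
by rewrite (big_pred1 tt) ?mulr1// => -[].
Qed.

(** The two systems are put side by side, with a block diagonal matrix. *)
Lemma lin_odeD f g : lin_ode f -> lin_ode g -> lin_ode (fun t => f t + g t).
Proof.
move=> [I [F [N [c [dF fE]]]]] [J [G [M [d [dG gE]]]]].
exists (I + J)%type,
  (fun k => match k with inl i => F i | inr j => G j end),
  (fun k l => match k, l with
     | inl i, inl i' => N i i' | inr j, inr j' => M j j' | _, _ => 0 end),
  (fun k => match k with inl i => c i | inr j => d j end).
split=> t t0; last by rewrite big_sumType /= fE// gE.
case=> i; rewrite big_sumType /=.
- rewrite [X in _ + X]big1 ?addr0; first exact: dF.
  by move=> *; rewrite mul0r.
- rewrite [X in X + _]big1 ?add0r; first exact: dG.
  by move=> *; rewrite mul0r.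
Qed.

(** By the product rule, the products of components solve the system whose matrix is the Kronecker
    sum of [N] and [M]. *)
Lemma lin_odeM f g : lin_ode f -> lin_ode g -> lin_ode (fun t => f t * g t).
Proof.
move=> [I [F [N [c [dF fE]]]]] [J [G [M [d [dG gE]]]]].
exists (I * J)%type, (fun k t => F k.1 t * G k.2 t),
  (fun k l => N k.1 l.1 * (k.2 == l.2)%:R + (k.1 == l.1)%:R * M k.2 l.2),
  (fun k => c k.1 * d k.2).
split=> t t0.
  case=> i j; apply: (is_derive_eq (is_derive_mul (dF t t0 i) (dG t t0 j))) => /=.
  under [RHS]eq_bigr do rewrite mulrDl.
  rewrite big_split /=; congr (_ + _).
    rewrite -(pair_bigA _ (fun i' j' => N i i' * (j == j')%:R * (F i' t * G j' t))).
    rewrite mulr_suml; apply: eq_bigr => i' _ /=.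
    rewrite (bigD1 j)//= eqxx mulr1 big1 ?addr0 ?mulrA// => j' jj'.
    by rewrite eq_sym (negbTE jj') mulr0 mul0r.
  rewrite -(pair_bigA _ (fun i' j' => (i == i')%:R * M j j' * (F i' t * G j' t))).
  rewrite exchange_big mulr_sumr; apply: eq_bigr => j' _ /=.
  rewrite (bigD1 i)//= eqxx mul1r big1 ?addr0 1?mulrCA// => i' ii'.
  by rewrite eq_sym (negbTE ii') !mul0r.
rewrite fE// gE// mulr_suml -(pair_bigA _ (fun i j => c i * d j * (F i t * G j t))).
apply: eq_bigr => i _; rewrite mulr_sumr; apply: eq_bigr => j _ /=.
by rewrite mulrACA.
Qed.

(** The system is enlarged by [g] itself, whose derivative is the combination [c] of the old
    components. *)
Lemma lin_ode_antiderivative f g :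
  (forall t : R, 0 < t -> is_derive t (1 : R) g (f t)) -> lin_ode f -> lin_ode g.
Proof.
move=> dg [I [F [N [c [dF fE]]]]].
exists (unit + I)%type,
  (fun k => match k with inl _ => g | inr j => F j end),
  (fun k l => match k, l with
     | inl _, inr j => c j | inr j, inr j' => N j j' | _, _ => 0 end),
  (fun k => match k with inl _ => 1 | inr _ => 0 end).
split=> t t0; last first.
  rewrite big_sumType /= (big_pred1 tt); last by case.
  by rewrite mul1r big1 ?addr0// => *; rewrite mul0r.
case=> i; rewrite big_sumType /= [X in X + _]big1 ?add0r.
- by rewrite -fE//; exact: dg.
- by move=> *; rewrite mul0r.
- exact: dF.
- by move=> *; rewrite mul0r.
Qed.

Lemma lin_ode_sum (I : Type) (r : seq I) (f : I -> R -> R) :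
  (forall i, lin_ode (f i)) -> lin_ode (fun t => \sum_(i <- r) f i t).
Proof.
move=> fo; elim: r => [|i r IHr].
  by apply: lin_ode_ext (lin_ode_cst 0) => t _; rewrite big_nil.
by apply: lin_ode_ext (lin_odeD (fo i) IHr) => t _; rewrite big_cons.
Qed.

Lemma lin_ode_prod (I : Type) (r : seq I) (f : I -> R -> R) :
  (forall i, lin_ode (f i)) -> lin_ode (fun t => \prod_(i <- r) f i t).
Proof.
move=> fo; elim: r => [|i r IHr].
  by apply: lin_ode_ext (lin_ode_cst 1) => t _; rewrite big_nil.
by apply: lin_ode_ext (lin_odeM (fo i) IHr) => t _; rewrite big_cons.
Qed.

Lemma lin_ode_det (n : nat) (M : R -> 'M[R]_n) :
  (forall i j, lin_ode (fun t => M t i j)) -> lin_ode (fun t => \det (M t)).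
Proof.
move=> Mo; apply: lin_ode_sum => s; apply: lin_odeM; first exact: lin_ode_cst.
exact: lin_ode_prod.
Qed.

(** The column [j] of the exponential solves [x' = A x]; [c] selects its entry [i]. *)
Lemma lin_ode_expmx (n : nat) (A : 'M[R]_n) i j :
  lin_ode (fun t => expmx (t *: A) i j).
Proof.
exists 'I_n, (fun k t => expmx (t *: A) k j), (fun k l => A k l),
  (fun k => (k == i)%:R).
split=> t t0 => [k|].
  by apply: (is_derive_eq (derive_expmx A t k j)); rewrite mxE.
rewrite (bigD1 i)//= eqxx mul1r big1 ?addr0// => k /negbTE ->.
by rewrite mul0r.
Qed.

Lemma lin_ode_zeros_negligible f t1 : lin_ode f -> 0 < t1 -> f t1 != 0 ->
  lebesgue_measure.-negligible [set t | 0 < t /\ f t = 0].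
Proof.
move=> [I [F [N [c [dF fE]]]]] t10 ft1.
(* Enumerating the index type [I] turns the family into a column vector. *)
pose sumE (G : I -> R) : \sum_i G i = \sum_(k < #|I|) G (enum_val k) :=
  big_enum_val G.
pose F' t : 'cV[R]_#|I| := \col_k F (enum_val k) t.
pose N' : 'M[R]_#|I| := \matrix_(k, l) N (enum_val k) (enum_val l).
pose c' : 'rV[R]_#|I| := \row_k c (enum_val k).
have fE' t : 0 < t -> f t = (c' *m F' t) 0 0.
  by move=> t0; rewrite fE// mxE sumE; apply: eq_bigr => k _; rewrite !mxE.
have dF' (t : R) : 0 < t -> forall k,
    is_derive t (1 : R) (fun s => F' s k 0) ((N' *m F' t) k 0).
  move=> t0 k; rewrite (_ : (fun s => _) = F (enum_val k)).
    apply: (is_derive_eq (dF t t0 (enum_val k))).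
    by rewrite mxE sumE; apply: eq_bigr => l _; rewrite !mxE.
  by apply/funext => s; rewrite mxE.
have cF1 : (c' *m F' t1) 0 0 != 0 by rewrite -fE'.
apply: negligibleS (linear_system_zeros_negligible dF' t10 cF1).
by move=> t [t0 ft]; split=> //; rewrite -fE'.
Qed.

End LinearODE.

(** * Positive definite matrices *)

Section PositiveDefinite.
Context {R : realType} {n : nat}.
Local Open Scope sesquilinear_scope.
Local Notation C := (R[i]).
Implicit Types (M : 'M[C]_n).

Lemma adjmxM (m p q : nat) (M : 'M[C]_(m, p)) (N : 'M[C]_(p, q)) :
  (M *m N)^t* = N^t* *m M^t*.
Proof. by rewrite trmx_mul map_mxM. Qed.

Lemma adj_diagmx (d : 'rV[C]_n) : (forall i, d 0 i \is Num.real) ->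
  (diag_mx d)^t* = diag_mx d.
Proof.
move=> dr; rewrite tr_diag_mx map_diag_mx; congr diag_mx.
by apply/rowP => i; rewrite mxE; exact/CrealP.
Qed.

Lemma posdefmx_congr M (L : 'M[C]_n) :
  L \in unitmx -> posdefmx M -> posdefmx (L *m M *m L^t*).
Proof.
move=> Lu [/is_hermitianmxP]; rewrite expr0 scale1r => Mh Mp; split.
  apply/is_hermitianmxP; rewrite expr0 scale1r.
  by rewrite !adjmxM trmxCK -Mh mulmxA.
move=> x x0; have := Mp (L^t* *m x); rewrite adjmxM trmxCK !mulmxA; apply.
have Lu' : L^t* \in unitmx by rewrite map_unitmx unitmx_tr.
by apply: contra x0 => /eqP Lx; rewrite -(mulKmx Lu' x) Lx mulmx0.
Qed.

Lemma posdefmx_diag (d : 'rV[C]_n) i : posdefmx (diag_mx d) -> 0 < d 0 i.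
Proof.
move=> [_ /(_ (delta_mx i 0))]; rewrite trmx_delta map_delta_mx.
rewrite -rowE -colE !mxE eqxx mulr1n; apply.
by apply/eqP => /matrixP/(_ i 0)/eqP; rewrite !mxE !eqxx oner_eq0.
Qed.

(** The eigenvalues are positive because the diagonal form is congruent to [M] through the unitary
    [P]. *)
Lemma posdefmx_spectral M : posdefmx M ->
  exists (P : 'M[C]_n) (d : 'rV[C]_n), [/\ P \is unitarymx, forall i, 0 < d 0 i &
                  M = P^t* *m diag_mx d *m P].
Proof.
move=> Mp; have /hermitian_normalmx/orthomx_spectralP := Mp.1.
set P := spectralmx M; set d := spectral_diag M => ME.
have Pu : P \is unitarymx by exact: spectral_unitarymx.
rewrite invmx_unitary// in ME; exists P, d; split=> // i.
apply: posdefmx_diag; have := posdefmx_congr (unitarymx_unit Pu) Mp.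
rewrite [in X in posdefmx X]ME !mulmxA (unitarymxP Pu) mul1mx.
by rewrite -mulmxA (unitarymxP Pu) mulmx1.
Qed.

Lemma det_unitary_congr (P D : 'M[C]_n) :
  P \is unitarymx -> \det (P^t* *m D *m P) = \det D.
Proof.
move=> Pu; rewrite !det_mulmx mulrAC -det_mulmx.
by rewrite (mulmx1C (unitarymxP Pu)) det1 mul1r.
Qed.

Lemma posdefmx_det_gt0 M : posdefmx M -> 0 < \det M.
Proof.
move=> /posdefmx_spectral[P [d [Pu dp ->]]].
by rewrite det_unitary_congr// det_diag prodr_gt0.
Qed.

(** [L] is the inverse square root of the diagonal form composed with [P]; it reduces [M] to the
    identity. *)
Lemma posdefmx_sqrt M : posdefmx M ->
  exists2 L : 'M[C]_n, L \in unitmx & L *m M *m L^t* = 1%:M.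
Proof.
move=> /posdefmx_spectral[P [d [Pu dp ->]]].
pose s := \row_i (sqrtC (d 0 i))^-1.
have s0 i : 0 < s 0 i by rewrite mxE invr_gt0 sqrtC_gt0.
exists (diag_mx s *m P).
  rewrite unitmx_mul (unitarymx_unit Pu) andbT unitmxE det_diag unitfE.
  by rewrite prodf_seq_neq0; apply/allP => i _; rewrite gt_eqF.
rewrite adjmxM adj_diagmx => [|i]; last by rewrite ger0_real// ltW.
rewrite !mulmxA !(mulmxtVK _ Pu).
rewrite !mulmx_diag -diag_const_mx; congr diag_mx; apply/rowP => i.
rewrite !mxE mulrAC -expr2 exprVn sqrtCK mulVf//.
by rewrite gt_eqF.
Qed.

(* Congruence reduces the pair (M, N) to (1, K), for which the claim reads
   [k <= ((1 + k) / 2) ^+ 2] for each eigenvalue k of K. *)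
Lemma det_midpoint_lt M N : posdefmx M -> posdefmx N -> M != N ->
  \det M * \det N < \det (2^-1 *: (M + N)) ^+ 2.
Proof.
move=> Mp Np MN; have [L Lu LM] := posdefmx_sqrt Mp.
pose K := L *m N *m L^t*.
have [P [k [Pu kp KE]]] := posdefmx_spectral (posdefmx_congr Lu Np).
(* The eigenvalues of the reduced midpoint [(1 + K) / 2]. *)
pose r := \row_i (2^-1 * (1 + k 0 i)).
have midE : L *m (2^-1 *: (M + N)) *m L^t* = P^t* *m diag_mx r *m P.
  have -> : diag_mx r = 2^-1 *: (1%:M + diag_mx k).
    apply/matrixP => i j; rewrite !mxE.
    by case: eqVneq => [->|_]; rewrite ?mulr1n ?mulr0n ?addr0 ?mulr0.
  rewrite -scalemxAr -scalemxAl mulmxDr mulmxDl LM KE -[RHS]mulmxA.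
  rewrite -scalemxAl -scalemxAr; congr (_ *: _).
  by rewrite mulmxA mulmxDr mulmxDl mulmx1 (mulmx1C (unitarymxP Pu)).
(* Congruence by [L] multiplies all three determinants by [dl], which is positive because
   [dl * \det M = 1]. *)
pose dl := \det L * \det (L^t*).
have detE (X : 'M[C]_n) : \det (L *m X *m L^t*) = dl * \det X.
  by rewrite !det_mulmx mulrAC.
have dl0 : 0 < dl.
  by rewrite -(pmulr_lgt0 _ (posdefmx_det_gt0 Mp)) -detE LM det1 ltr01.
have dlM : dl * \det M = 1 by rewrite -detE LM det1.
have dlN : dl * \det N = \prod_i k 0 i.
  by rewrite -detE KE det_unitary_congr// det_diag.
have dlmid : dl * \det (2^-1 *: (M + N)) = \prod_i r 0 i.
  by rewrite -detE midE det_unitary_congr// det_diag.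
suff : (dl * \det M) * (dl * \det N) < (dl * \det (2^-1 *: (M + N))) ^+ 2.
  by rewrite exprMn mulrACA -expr2 ltr_pM2l// exprn_gt0.
rewrite dlM dlN dlmid mul1r -prodrXl.
have rE i : r 0 i ^+ 2 - k 0 i = (2^-1 * (k 0 i - 1)) ^+ 2.
  by rewrite mxE; field.
have kreal i : 2^-1 * (k 0 i - 1) \is Num.real.
  by rewrite rpredM ?rpredB ?rpredV ?realn ?ger0_real// ltW.
have kr i : k 0 i <= r 0 i ^+ 2.
  by rewrite -subr_ge0 rE; exact: real_exprn_even_ge0.
(* If all eigenvalues were 1, then [K = 1 = L M L^t*] and cancelling [L] would give [M = N]. An
   eigenvalue other than 1 makes its factor of the product strict. *)
have [i ki] : exists i, k 0 i != 1.
  apply/existsP; rewrite -negb_forall; apply: contra MN => /forallP k1.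
  have K1 : L *m N *m L^t* = 1%:M.
    rewrite KE (_ : diag_mx k = 1%:M).
      by rewrite mulmx1 (mulmx1C (unitarymxP Pu)).
    rewrite -diag_const_mx; congr diag_mx; apply/rowP => i.
    by rewrite !mxE (eqP (k1 i)).
  have Lu' : L^t* \in unitmx by rewrite map_unitmx unitmx_tr.
  have /(can_inj (mulmxK Lu'))/(can_inj (mulKmx Lu)) : 
    L *m M *m L^t* = L *m N *m L^t* by rewrite LM K1.
  by move->.
rewrite (bigD1 i)//= [ltRHS](bigD1 i)//=.
apply: (@lt_le_trans _ _ (r 0 i ^+ 2 * \prod_(j | j != i) k 0 j)).
  rewrite ltr_pM2r ?prodr_gt0//.
  rewrite lt_neqAle kr andbT eq_sym -subr_eq0 rE.
  by rewrite expf_eq0/= mulf_neq0 ?subr_eq0// invr_eq0 pnatr_eq0.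
rewrite ler_wpM2l//; first by rewrite (le_trans _ (kr i))// ltW.
by apply: ler_prod => j _; rewrite kr ltW.
Qed.

End PositiveDefinite.

(** * Real symmetric matrices *)

Section RealPositiveDefinite.
Context {R : realType} {n : nat}.
Local Open Scope sesquilinear_scope.
Local Open Scope complex_scope.
Implicit Types (M N : 'M[R]_n) (u v x y : 'cV[R]_n).

Lemma cplxmx_adj (m p : nat) (M : 'M[R]_(m, p)) : (cplxmx M)^t* = cplxmx M^T.
Proof.
apply/matrixP => i j; rewrite !mxE; apply/CrealP.
by apply/complex_realP; eexists.
Qed.

Lemma cplxmx_hermP M : reflect (M^T = M) (cplxmx M \is hermsymmx).
Proof.
apply: (iffP (is_hermitianmxP _ _ _)); rewrite expr0 scale1r cplxmx_adj.
  by move=> /matrixP ME; apply/matrixP => i j; have := ME i j; rewrite !mxE => -[].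
by move->.
Qed.

Lemma det_cplxmx M : \det (cplxmx M) = (\det M)%:C.
Proof. exact: det_map_mx. Qed.

Lemma posdefmx_real M : posdefmx (cplxmx M) -> 0 < \det M.
Proof. by move=> /posdefmx_det_gt0; rewrite det_cplxmx ltcR. Qed.

(** For [z = u + i v] the cross terms cancel by symmetry of [M], and the quadratic form at [z] is
    the sum of those at [u] and [v]. *)
Lemma posdefmxP M : posdefmx (cplxmx M) <->
  M^T = M /\ forall x, x != 0 -> 0 < (x^T *m M *m x) 0 0.
Proof.
split=> [[/cplxmx_hermP Ms Mp]|[Ms Mp]].
  split=> // x x0; have := Mp (cplxmx x).
  rewrite cplxmx_adj -!cplxmxM mxE ltcR; apply.
  apply: contra x0 => /eqP/matrixP xE; apply/eqP/matrixP => i j.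
  by have := xE i j; rewrite !mxE => -[].
split; first exact/cplxmx_hermP.
move=> z z0; pose u := map_mx (@complex.Re R) z; pose v := map_mx (@complex.Im R) z.
have zE : z = cplxmx u + 'i *: cplxmx v.
  by apply/matrixP => i j; rewrite !mxE [LHS]complexE.
have zaE : z^t* = cplxmx u^T - 'i *: cplxmx v^T.
  apply/matrixP => i j; rewrite !mxE; case: (z j i) => a b /=.
  by apply/eqP; rewrite eq_complex /=; apply/andP; split; apply/eqP; ring.
have uMv : v^T *m M *m u = u^T *m M *m v.
  apply/matrixP => i j; rewrite (ord1 i) (ord1 j).
  rewrite -[LHS](_ : (v^T *m M *m u)^T 0 0 = _); last by rewrite mxE.
  by rewrite !trmx_mul trmxK Ms mulmxA.
have zMz : z^t* *m cplxmx M *m z = cplxmx (u^T *m M *m u + v^T *m M *m v).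
  rewrite zaE zE !mulmxBl !mulmxDr -!scalemxAl -!scalemxAr.
  rewrite -!cplxmxM uMv scalerA -expr2 sqrCi scaleN1r.
  by rewrite opprB addrACA subrr addr0 /cplxmx map_mxD.
rewrite zMz mxE ltcR mxE.
have ge0 x : 0 <= (x^T *m M *m x) 0 0.
  by have [->|/Mp/ltW//] := eqVneq x 0; rewrite mulmx0 mxE.
have [u0|/Mp u0] := eqVneq u 0; last exact: ltr_wpDr.
have v0 : v != 0.
  apply: contra z0 => /eqP v0; rewrite zE u0 v0.
  by apply/eqP/matrixP => i j; rewrite !mxE mulr0 addr0.
by apply: ltr_wpDl; [exact: ge0|exact: Mp].
Qed.

(** With [y = M x], the form at [x + l y] is [l (2 a + l b)], where [a] is the squared length of
    [y]. It would be negative for small negative [l] if [a] were positive. *)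
Lemma psd_ker M x : M^T = M -> (forall y, 0 <= (y^T *m M *m y) 0 0) ->
  (x^T *m M *m x) 0 0 = 0 -> M *m x = 0.
Proof.
move=> Ms Mp x0; pose y := M *m x; pose a := (y^T *m y) 0 0.
pose b := (y^T *m M *m y) 0 0.
have quad (l : R) : (((x + l *: y)^T *m M *m (x + l *: y)) 0 0) =
    l * (2 * a + l * b).
  have -> : (x + l *: y)^T = x^T + l *: y^T.
    by apply/matrixP => i j; rewrite !mxE.
  rewrite !mulmxDl !mulmxDr -!scalemxAl -!scalemxAr.
  have -> : x^T *m M *m y = y^T *m y by rewrite [y^T]trmx_mul Ms.
  have -> : y^T *m M *m x = y^T *m y by rewrite -mulmxA.
  rewrite !mxE in x0 *; rewrite x0 /a /b !mxE; ring.
have a0 : 0 <= a by rewrite /a mxE; apply: sumr_ge0 => i _; rewrite mxE -expr2 sqr_ge0.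
have b0 : 0 <= b by exact: Mp.
have a_eq0 : a = 0.
  apply/eqP; rewrite eq_le a0 andbT leNgt; apply/negP => agt0.
  (* For this [l] the factor [2 a + l b] exceeds [a]; the denominator [b + 1] stays positive when
     [b = 0]. *)
  have := Mp (x + (- (a / (b + 1))) *: y); rewrite quad leNgt => /negP; apply.
  have b1 : 0 < b + 1 by rewrite ltr_wpDl.
  rewrite nmulr_rlt0 ?oppr_lt0 ?divr_gt0//.
  rewrite mulNr subr_gt0 mulrAC ltr_pdivrMr//.
  nra.
apply/matrixP => i j; rewrite (ord1 j) [RHS]mxE -/y.
move: a_eq0; rewrite /a mxE => /eqP.
rewrite psumr_eq0 => [/allP/(_ i)|k _]; last by rewrite mxE -expr2 sqr_ge0.
by rewrite mem_index_enum mxE mulf_eq0 orbb => /(_ isT)/eqP.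
Qed.

Lemma psd_det_posdefmx M : M^T = M -> (forall y, 0 <= (y^T *m M *m y) 0 0) ->
  \det M != 0 -> posdefmx (cplxmx M).
Proof.
move=> Ms Mp Md; apply/posdefmxP; split=> // x x0.
rewrite lt_neqAle Mp andbT eq_sym; apply: contra x0 => /eqP /(psd_ker Ms Mp) Mx.
have Mu : M \in unitmx by rewrite unitmxE unitfE.
by rewrite -(mulKmx Mu x) Mx mulmx0.
Qed.

End RealPositiveDefinite.

(** * The Gramian *)

Section IntegralFromZero.
Context {R : realType}.
Implicit Types (f : R -> R) (a b t T : R).

Lemma continuous_integrable f T : continuous f ->
  lebesgue_measure.-integrable `[0, T] (EFin \o f).
Proof.
move=> fc; apply: continuous_compact_integrable; first exact: segment_compact.
exact: continuous_subspaceT.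
Qed.

Lemma Rintegral_bigsum (I : Type) (r : seq I) (f : I -> R -> R) T :
  (forall i, continuous (f i)) ->
  (\int[lebesgue_measure]_(t in `[0, T]) \sum_(i <- r) f i t)%R =
  \sum_(i <- r) (\int[lebesgue_measure]_(t in `[0, T]) f i t)%R.
Proof.
move=> fc; have sc s : continuous (fun t => \sum_(i <- s) f i t).
  by move=> t; apply: cvg_sum => i _; exact: fc.
elim: r => [|i r IHr].
  under eq_Rintegral do rewrite big_nil.
  by rewrite big_nil Rintegral_cst// mul0r.
under eq_Rintegral do rewrite big_cons.
rewrite big_cons -IHr RintegralD//; exact: continuous_integrable.
Qed.

Lemma Rintegral_scale f a T : continuous f ->
  (\int[lebesgue_measure]_(t in `[0, T]) (a * f t))%R =
  a * (\int[lebesgue_measure]_(t in `[0, T]) f t)%R.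
Proof. by move=> fc; rewrite RintegralZl//; exact: continuous_integrable. Qed.

Lemma is_derive_Rintegral f t : continuous f -> 0 < t ->
  is_derive t (1 : R)
    (fun T => (\int[lebesgue_measure]_(x in `[0, T]) f x)%R) (f t).
Proof.
(* The upper bound [t + 1] makes [t] interior to the interval. *)
move=> fc t0; have [|dF FE] := @continuous_FTC1_closed R f 0 t (t + 1) _
  (@continuous_integrable f _ fc) t0 (fc t); first by rewrite ltrDl.
by constructor; [exact: dF|rewrite -derive1E; exact: FE].
Qed.

Lemma Rintegral_MVT f a b : continuous f -> 0 <= a <= b ->
  exists2 c, c \in `[a, b] &
    (\int[lebesgue_measure]_(t in `[0, b]) f t)%R -
    (\int[lebesgue_measure]_(t in `[0, a]) f t)%R = f c * (b - a).
Proof.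
move=> fc /andP[a0 ab].
apply: (@MVT_segment R (fun T =>
    (\int[lebesgue_measure]_(t in `[0, T]) f t)%R) f) => // [t|].
  by rewrite in_itv/= => /andP[ta _]; apply: is_derive_Rintegral; rewrite ?(le_lt_trans a0).
(* The case [a = 0] is allowed, where the derivative is not at hand; continuity of the primitive on
   the closed interval is proved separately. *)
have := parameterized_integral_continuous (le_trans a0 ab)
  (@continuous_integrable f b fc).
apply: continuous_subspaceW => t; rewrite /= !in_itv/= => /andP[at_ ->].
by rewrite (le_trans a0).
Qed.

Lemma Rintegral_gt0 f T : continuous f -> (forall t, 0 <= f t) -> 0 < f 0 ->
  0 < T -> 0 < (\int[lebesgue_measure]_(t in `[0, T]) f t)%R.
Proof.
move=> fc f0 f00 T0.
have /cvgrPdist_lt/(_ _ f00)/nbhs_ballP[e /= e0 eP] := fc 0.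
(* On [[0, d]], inside the ball where [f] is positive, the mean value theorem gives a positive
   integral; the rest of [[0, T]] contributes a nonnegative amount. *)
pose d := Num.min T (e / 2).
have d0 : 0 < d by rewrite lt_min T0 divr_gt0.
have [c] := @Rintegral_MVT f 0 d fc ltac:(by rewrite lexx ltW).
rewrite in_itv/= => /andP[c0 cd].
rewrite set_itv1 Rintegral_set1 !subr0 => dE.
have fc0 : 0 < f c.
  have /eP : ball 0 e c.
    rewrite /ball/= sub0r normrN ger0_norm//.
    by rewrite (le_lt_trans cd)// gt_min ltr_pdivrMr// ltr_pMr// ltr1n orbT.
  by rewrite ltr_distlC subrr => /andP[].
have [c' _] := @Rintegral_MVT f d T fc ltac:(by rewrite ltW// ge_min lexx).
rewrite dE => /eqP; rewrite subr_eq => /eqP ->.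
apply: ltr_wpDl; last exact: mulr_gt0.
by rewrite mulr_ge0// subr_ge0 ge_min lexx.
Qed.

(** The mean over [[0, T]] is a value [f c] with [c] in [[0, T]], so [c] tends to 0 with [T]. *)
Lemma Rintegral_mean_cvg f : continuous f ->
  T^-1 * (\int[lebesgue_measure]_(t in `[0, T]) f t)%R @[T --> 0^'+] --> f 0.
Proof.
move=> fc; apply/cvgrPdist_lt => e e0.
have /cvgrPdist_lt/(_ _ e0)/nbhs_ballP[d /= d0 dP] := fc 0.
near=> T.
have T0 : 0 < T by near: T; exact: nbhs_right_gt.
have [c] := @Rintegral_MVT f 0 T fc ltac:(by rewrite lexx ltW).
rewrite in_itv/= => /andP[c0 cT].
rewrite set_itv1 Rintegral_set1 !subr0 => ->.
rewrite mulrCA mulVf ?gt_eqF// mulr1; apply: dP.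
rewrite /ball/= sub0r normrN ger0_norm// (le_lt_trans cT)//.
Unshelve. all: by end_near. Qed.

End IntegralFromZero.

(** * Positivity and injectivity of the Gramian *)

Section Gramian.
Context {R : realType} {n : nat}.
Context (A : 'M[R]_n).
Implicit Types (p q : 'rV[R]_n) (T t : R) (x : 'cV[R]_n).

Lemma gramian_iE T i j k : gramian_i A T i j k =
  (\int[lebesgue_measure]_(t in `[0, T])
     (expmx (t *: A) j i * expmx (t *: A) k i))%R.
Proof.
rewrite mxE; apply: eq_Rintegral => t _.
rewrite -colE -mulmxA trmx_delta -rowE mxE big_ord1.
by rewrite expmx_tr !mxE.
Qed.

Lemma gramianE p T j k : gramian A p T j k =
  \sum_i p 0 i * (\int[lebesgue_measure]_(t in `[0, T])
     (expmx (t *: A) j i * expmx (t *: A) k i))%R.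
Proof.
by rewrite /gramian summxE; apply: eq_bigr => i _; rewrite mxE gramian_iE.
Qed.

Lemma gramian_sym p T : (gramian A p T)^T = gramian A p T.
Proof.
apply/matrixP => j k; rewrite mxE !gramianE; apply: eq_bigr => i _.
by congr (_ * _); apply: eq_Rintegral => t _; rewrite mulrC.
Qed.

Lemma continuous_expmxM i j k l :
  continuous (fun t => expmx (t *: A) i j * expmx (t *: A) k l).
Proof. by move=> t; apply: cvgM; exact: continuous_expmx. Qed.

Lemma continuous_expmx_row x i :
  continuous (fun t => (x^T *m expmx (t *: A)) 0 i).
Proof.
rewrite (_ : (fun t => _) = fun t => \sum_j x^T 0 j * expmx (t *: A) j i).
  move=> t; apply: cvg_sum => j _; apply: cvgM; first exact: cvg_cst.
  exact: continuous_expmx.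
by apply/funext => t; rewrite mxE.
Qed.

(** Writing the form as a weighted sum of integrals of squares makes its sign visible. *)
Lemma gramian_quad p T x : (x^T *m gramian A p T *m x) 0 0 =
  \sum_i p 0 i * (\int[lebesgue_measure]_(t in `[0, T])
    (x^T *m expmx (t *: A)) 0 i ^+ 2)%R.
Proof.
rewrite /gramian mulmx_sumr mulmx_suml summxE; apply: eq_bigr => i _.
rewrite -scalemxAr -scalemxAl mxE; congr (_ * _).
under [RHS]eq_Rintegral => t _.
  rewrite mxE expr2 mulr_suml.
  under eq_bigr do rewrite mulr_sumr.
  over.
rewrite Rintegral_bigsum; last first.
  move=> j t; apply: cvg_sum => k _.
  by apply: cvgM; (apply: cvgM; [exact: cvg_cst|exact: continuous_expmx]).
rewrite mxE; under eq_bigr do rewrite mxE mulr_suml.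
rewrite exchange_big /=; apply: eq_bigr => j _.
rewrite Rintegral_bigsum; last first.
  move=> k t.
  by apply: cvgM; (apply: cvgM; [exact: cvg_cst|exact: continuous_expmx]).
apply: eq_bigr => k _; rewrite gramian_iE mxE.
under [RHS]eq_Rintegral => t _ do rewrite mxE mulrACA.
rewrite Rintegral_scale; last exact: continuous_expmxM.
by rewrite mulrAC.
Qed.

Lemma gramian_psd p T x : (forall i, 0 <= p 0 i) ->
  0 <= (x^T *m gramian A p T *m x) 0 0.
Proof.
move=> p0; rewrite gramian_quad; apply: sumr_ge0 => i _; apply: mulr_ge0 => //.
by apply: Rintegral_ge0 => t _; exact: sqr_ge0.
Qed.

Lemma gramian_posdef p T : 0 < T -> (forall i, 0 < p 0 i) ->
  posdefmx (cplxmx (gramian A p T)).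
Proof.
move=> T0 p0; apply/posdefmxP; split; first exact: gramian_sym.
move=> x x0; rewrite gramian_quad.
have [i xi] : exists i, x i 0 != 0.
  apply/existsP; rewrite -negb_forall; apply: contra x0 => /forallP x0.
  by apply/eqP/matrixP => i j; rewrite (ord1 j) mxE (eqP (x0 i)).
(* The term of a coordinate with [x i 0 != 0] is positive, since its integrand at time 0 is the
   square of that coordinate. *)
rewrite (bigD1 i)//=; apply: ltr_wpDr.
  apply: sumr_ge0 => j _; apply: mulr_ge0; first exact/ltW.
  by apply: Rintegral_ge0 => t _; exact: sqr_ge0.
apply: mulr_gt0 => //; apply: Rintegral_gt0 => // [t|t|].
- by apply: cvgM; exact: continuous_expmx_row.
- exact: sqr_ge0.
- by rewrite expmx0 mulmx1 mxE exprn_even_gt0.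
Qed.

Lemma gramianD p q T (a b : R) :
  gramian A (a *: p + b *: q) T = a *: gramian A p T + b *: gramian A q T.
Proof.
rewrite /gramian !scaler_sumr -big_split; apply: eq_bigr => i _ /=.
by rewrite !mxE scalerDl !scalerA.
Qed.

(** The column [i] is the diagonal of the [i]-th Gramian, so this is the matrix of the linear map
    sending [p] to the diagonal of [gramian A p T]. *)
Definition gramian_diags T : 'M[R]_n := \matrix_(j, i) gramian_i A T i j j.

Lemma gramian_inj T : \det (gramian_diags T) != 0 ->
  injective (fun p => gramian A p T).
Proof.
move=> d0 p q /= pq; apply/eqP; rewrite -subr_eq0; apply/eqP.
have Du : gramian_diags T \in unitmx by rewrite unitmxE unitfE.
have Du' : (gramian_diags T)^T \in unitmx by rewrite unitmx_tr.
apply: (can_inj (mulmxK Du')); rewrite mul0mx.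
apply/rowP => j; rewrite mxE [RHS]mxE.
have /matrixP/(_ j j) := pq; rewrite /gramian !summxE => /eqP.
rewrite -subr_eq0 -sumrB => /eqP {2}<-; apply: eq_bigr => i _.
by rewrite !mxE mulrBl.
Qed.

Lemma gramian_diags_lin_ode i j : lin_ode (fun T => gramian_diags T i j).
Proof.
apply: (@lin_ode_antiderivative _ (fun t => expmx (t *: A) i j * expmx (t *: A) i j)).
  move=> t t0; rewrite (_ : (fun T => _) = (fun T =>
      (\int[lebesgue_measure]_(s in `[0%R, T])
        (expmx (s *: A) i j * expmx (s *: A) i j))%R)).
    by apply: is_derive_Rintegral => //; exact: continuous_expmxM.
  by apply/funext => T; rewrite mxE gramian_iE.
by apply: lin_odeM; exact: lin_ode_expmx.
Qed.

(** The entries divided by [T] are means of squares of entries of [exp(tA)]; as [T] tends to 0 they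
    tend to the entries of the identity, which equal their own squares. *)
Lemma gramian_diags_det_neq0 :
  exists2 T : R, 0 < T & \det (gramian_diags T) != 0.
Proof.
have : \det (T^-1 *: gramian_diags T) @[T --> (0 : R)^'+] --> \det (1%:M : 'M[R]_n).
  apply: cvg_det; apply/cvg_mxP => i j.
  have := @Rintegral_mean_cvg _ _ (@continuous_expmxM i j i j).
  rewrite expmx0 (_ : 1%:M i j * 1%:M i j = (1%:M : 'M[R]_n) i j :> R).
    by under [X in _ -> X]eq_cvg do rewrite mxE mxE gramian_iE.
  by rewrite mxE; case: eqP => _; rewrite ?mulr1 ?mulr0.
rewrite det1 => /cvgrPdist_lt/(_ 1 ltr01) near1.
near (0 : R)^'+ => T; exists T; first by near: T; exact: nbhs_right_gt.
have : `|1 - \det (T^-1 *: gramian_diags T)| < 1 by near: T.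
apply: contraTneq => D0; rewrite detZ D0 mulr0 subr0 normr1.
by rewrite ltxx.
Unshelve. all: by end_near. Qed.

Lemma gramian_inj_ae : {ae lebesgue_measure, forall T : R, 0 < T ->
  injective (fun p => gramian A p T)}.
Proof.
have [T1 T10 dT1] := gramian_diags_det_neq0.
have := lin_ode_zeros_negligible (lin_ode_det gramian_diags_lin_ode) T10 dT1.
apply: negligibleS => T /= /not_implyP[T0 Tinj]; split=> //.
by apply/eqP/negPn/negP => /gramian_inj.
Qed.

End Gramian.

(** * Change of coordinates *)

(** In the application [V] is the inverse of [S], and [V'], [S'] are the adjoints of [V], [S]. *)
Lemma mulmx_cancel_congr (K : pzRingType) (n : nat)
    (V S V' S' E B B' E' : 'M[K]_n) : S *m V = 1%:M -> V' *m S' = 1%:M ->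
  V *m E *m S *m (V *m B) *m (B' *m V') *m (S' *m E' *m V') =
  V *m (E *m (B *m B') *m E') *m V'.
Proof.
move=> SV VS; rewrite !mulmxA -(mulmxA _ S V) SV mulmx1.
by rewrite -(mulmxA _ V' S') VS mulmx1.
Qed.

Section ChangeOfCoordinates.
Context {R : realType} {n : nat}.
Local Open Scope sesquilinear_scope.
Local Open Scope complex_scope.
Implicit Types (A : 'M[R]_n) (S P Q : 'M[R[i]]_n) (p : 'rV[R]_n) (T t : R).

(** Each entry is a combination of the real entries of [G] with constant complex coefficients, so
    the real and imaginary parts integrate separately. *)
Lemma cmxintegral_congr (G : R -> 'M[R]_n) P Q T :
  (forall i j, continuous (fun t => G t i j)) ->
  cmxintegral T (fun t => P *m cplxmx (G t) *m Q) =
  P *m cplxmx (mxintegral T G) *m Q.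
Proof.
move=> Gc; apply/matrixP => i j; rewrite mxE.
have entryE (M : 'M[R]_n) : (P *m cplxmx M *m Q) i j =
    \sum_k \sum_l P i l * Q k j * (M l k)%:C.
  rewrite mxE; apply: eq_bigr => k _; rewrite mxE mulr_suml.
  by apply: eq_bigr => l _; rewrite mxE mulrAC.
have ReE (z : R[i]) (a : R) : complex.Re (z * a%:C) = complex.Re z * a.
  by case: z => x y /=; rewrite mulr0 subr0.
have ImE (z : R[i]) (a : R) : complex.Im (z * a%:C) = complex.Im z * a.
  by case: z => x y /=; rewrite mulr0 add0r.
(* Here [h] stands for the real or the imaginary part, and [w] for the matching part of the
   coefficients. *)
have intE (h : R[i] -> R) (w : 'I_n -> 'I_n -> R) :
    (forall t, h ((P *m cplxmx (G t) *m Q) i j) =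
       \sum_k \sum_l w k l * G t l k) ->
    (\int[lebesgue_measure]_(t in `[0%R, T])
       h ((P *m cplxmx (G t) *m Q) i j))%R =
    \sum_k \sum_l w k l * mxintegral T G l k.
  move=> hE; under eq_Rintegral do rewrite hE.
  have cw k l : continuous (fun t => w k l * G t l k).
    by move=> t; apply: cvgM; [exact: cvg_cst|exact: Gc].
  rewrite Rintegral_bigsum => [|k t]; last first.
    by apply: cvg_sum => l _; exact: cw.
  apply: eq_bigr => k _; rewrite Rintegral_bigsum; last exact: cw.
  by apply: eq_bigr => l _; rewrite Rintegral_scale// mxE.
rewrite (intE _ (fun k l => complex.Re (P i l * Q k j))); last first.
  move=> t; rewrite entryE raddf_sum; apply: eq_bigr => k _ /=.
  by rewrite raddf_sum; apply: eq_bigr => l _ /=; rewrite ReE.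
rewrite (intE _ (fun k l => complex.Im (P i l * Q k j))); last first.
  move=> t; rewrite entryE raddf_sum; apply: eq_bigr => k _ /=.
  by rewrite raddf_sum; apply: eq_bigr => l _ /=; rewrite ImE.
rewrite entryE; apply/eqP; rewrite eq_complex /=; apply/andP; split; apply/eqP.
  rewrite raddf_sum; apply: eq_bigr => k _ /=.
  by rewrite raddf_sum; apply: eq_bigr => l _ /=; rewrite ReE.
rewrite raddf_sum; apply: eq_bigr => k _ /=.
by rewrite raddf_sum; apply: eq_bigr => l _ /=; rewrite ImE.
Qed.

Lemma expmx_diag_expmx_tr A (d : 'rV[R]_n) t i j :
  (expmx (t *: A) *m diag_mx d *m (expmx (t *: A))^T) i j =
  \sum_k d 0 k * (expmx (t *: A) i k * expmx (t *: A) j k).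
Proof.
rewrite mxE; apply: eq_bigr => k _.
by rewrite mul_mx_diag !mxE; ring.
Qed.

Lemma gramian_mxintegral A p T : gramian A p T =
  mxintegral T (fun t => expmx (t *: A) *m diag_mx p *m (expmx (t *: A))^T).
Proof.
apply/matrixP => i j; rewrite gramianE mxE.
under [RHS]eq_Rintegral do rewrite expmx_diag_expmx_tr.
rewrite Rintegral_bigsum => [|k t].
  by apply: eq_bigr => k _; rewrite Rintegral_scale//; exact: continuous_expmxM.
by apply: cvgM; [exact: cvg_cst|exact: continuous_expmxM].
Qed.

Lemma gramian_tildeE A S p T : S \in unitmx -> (forall i, 0 <= p 0 i) ->
  gramian_tilde A S p T = invmx S *m cplxmx (gramian A p T) *m (invmx S)^t*.
Proof.
move=> Su p0; rewrite gramian_mxintegral -cmxintegral_congr; last first.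
  move=> i j; under eq_fun do rewrite expmx_diag_expmx_tr.
  move=> t; apply: cvg_sum => k _.
  by apply: cvgM; [exact: cvg_cst|exact: continuous_expmxM].
rewrite /gramian_tilde /=; congr cmxintegral; apply/funext => t.
have SS : (invmx S)^t* *m S^t* = 1%:M by rewrite -adjmxM mulmxV// trmx1 map_mx1.
(* Nonnegativity of [p] enters here: the square roots square back to [p]. *)
have BB : cplxmx (input_mx p) *m (cplxmx (input_mx p))^t* = cplxmx (diag_mx p).
  rewrite cplxmx_adj -cplxmxM /input_mx tr_diag_mx mulmx_diag.
  congr (cplxmx (diag_mx _)); apply/rowP => i.
  by rewrite !mxE -expr2 sqr_sqrtr.
have AS : (invmx S *m cplxmx A *m S)^t* = S^t* *m cplxmx A^T *m (invmx S)^t*.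
  by rewrite !adjmxM cplxmx_adj mulmxA.
rewrite AS (@expmx_similar _ _ A _ _ t (mulmxV Su)).
rewrite (@expmx_similar _ _ A^T _ _ t SS) expmx_tr adjmxM.
by rewrite (mulmx_cancel_congr _ _ _ _ (mulmxV Su) SS) BB -!cplxmxM.
Qed.

(** The factor [d] is the squared modulus of the determinant of the inverse of [S], the same for all
    [p]. *)
Lemma det_gramian_tilde A S T : S \in unitmx -> exists2 d : R, 0 < d &
  forall p, (forall i, 0 <= p 0 i) ->
    complex.Re (\det (gramian_tilde A S p T)) = d * \det (gramian A p T).
Proof.
move=> Su; set z := \det (invmx S).
have z0 : z != 0 by rewrite /z det_inv invr_eq0 -unitfE -unitmxE.
have zz : 0 < z * z^* by rewrite -normCK exprn_gt0// normr_gt0.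
have dd : complex.Im (z * z^*) = 0 /\ 0 < complex.Re (z * z^*).
  by move: zz; rewrite ltcE /= => /andP[/eqP].
exists (complex.Re (z * z^*)); first by case: dd.
move=> p p0; rewrite gramian_tildeE// !det_mulmx det_cplxmx mulrAC.
have -> : \det ((invmx S)^t*) = z^* by rewrite det_map_mx det_tr.
rewrite -/z.
by move: dd; case: (z * z^*) => a b /= [-> _]; rewrite mul0r subr0.
Qed.

End ChangeOfCoordinates.

(** * Existence and uniqueness of minimizers *)

Section Optimization.
Context {R : realType} {n : nat}.
Context (A : 'M[R]_n) (T : R).
Implicit Types (p q : 'rV[R]_n).
Local Notation W p := (gramian A p T).
Local Notation D := (feasible_pd A T `&` simplex R n).

Lemma continuous_det_gramian : continuous (fun p => \det (W p)).
Proof.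
move=> p; apply: (@cvg_det _ _ (nbhs p) _ _ (fun p => W p)).
apply: (proj2 (cvg_mxP (fun p => W p) _)) => j k.
rewrite gramianE; under eq_cvg do rewrite gramianE.
apply: cvg_sum => i _; apply: cvgM; last exact: cvg_cst.
exact: coord_continuous.
Qed.

Lemma compact_simplex : compact (simplex R n).
Proof.
apply: bounded_closed_compact.
  (* Nonnegative coordinates with sum 1 are at most 1, which bounds the sup norm. *)
  exists 1; split=> // M M1 p [p1 p0] /=.
  have M0 : 0 <= M by rewrite ltW// (lt_trans ltr01).
  rewrite [leLHS]mx_normrE; apply/bigmax_leP; split=> // -[i j] _ /=.
  rewrite (ord1 i) ger0_norm//; apply: le_trans (ltW M1).
  by rewrite -p1 (bigD1 j)//= lerDl; exact: sumr_ge0.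
have coordc i : continuous (fun p => p 0 i).
  exact: coord_continuous.
have -> : simplex R n = (fun p => \sum_i p 0 i) @^-1` [set 1] `&`
    \bigcap_i ((fun p => p 0 i) @^-1` [set x | 0 <= x]).
  apply/seteqP; split=> p [p1 p0]; split=> // i; first by move=> _; exact: p0.
  exact: p0 i I.
apply: closedI.
  apply: closed_comp => [p _|]; last exact: closed_eq.
  by apply: (@cvg_sum _ _ _ (nbhs p)) => i _; exact: coordc.
by apply: closed_bigI => i _; apply: closed_comp => [p _|];
  [exact: coordc|exact: closed_ge].
Qed.

Lemma feasible_det_gt0 p : feasible_pd A T p -> 0 < \det (W p).
Proof. exact: posdefmx_real. Qed.

Lemma simplex_det_feasible p : simplex R n p -> 0 < \det (W p) ->
  feasible_pd A T p.
Proof.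
move=> [_ p0] d0; apply: psd_det_posdefmx; first exact: gramian_sym.
  by move=> x; exact: gramian_psd.
by rewrite gt_eqF.
Qed.

Lemma vcs_minimizer_exists : (0 < n)%N -> 0 < T ->
  exists p, minimizer (vcs_objective A T) D p.
Proof.
move=> n0 T0; pose u : 'rV[R]_n := const_mx n%:R^-1.
have us : simplex R n u.
  split=> [|i]; last by rewrite mxE invr_ge0.
  under eq_bigr do rewrite mxE.
  by rewrite sumr_const card_ord -[X in X *+ _]mul1r -mulrnAr -[_ *+ n]mulr_natl
    mul1r mulfV// pnatr_eq0 -lt0n.
have uf : 0 < \det (W u).
  apply: feasible_det_gt0; apply: gramian_posdef => // i.
  by rewrite mxE invr_gt0 ltr0n.
(* The maximum is taken over the whole simplex, because its feasible part need not be closed. *)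
have [p ps pmax] := @EVT_max_rV R n (fun p => \det (W p)) _
  (ex_intro _ u us) compact_simplex
  (continuous_subspaceT continuous_det_gramian).
rewrite inE in ps.
have p0 : 0 < \det (W p) by apply: lt_le_trans uf _; apply: pmax; rewrite inE.
exists p; split; first by split=> //; exact: simplex_det_feasible.
move=> q [qf qs]; rewrite /vcs_objective lerN2 ler_ln ?posrE//.
  by apply: pmax; rewrite inE.
exact: feasible_det_gt0.
Qed.

Lemma vcs_minimizer_unique p q : injective (fun p => W p) ->
  minimizer (vcs_objective A T) D p -> minimizer (vcs_objective A T) D q -> p = q.
Proof.
move=> Winj [[pf [p1 p0]] pmin] [[qf [q1 q0]] qmin]; apply/eqP/negPn/negP => pq.
have dp := feasible_det_gt0 pf; have dq := feasible_det_gt0 qf.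
have dE : \det (W p) = \det (W q).
  apply: ln_inj; rewrite ?posrE//; apply/oppr_inj/eqP.
  by rewrite eq_le pmin// qmin.
(* Both minimizers have the same determinant; the midpoint has a strictly larger one, against
   minimality of [q]. *)
pose m := 2^-1 *: p + 2^-1 *: q.
have Wm : W m = 2^-1 *: (W p + W q) by rewrite gramianD scalerDr.
have WN : cplxmx (W p) != cplxmx (W q).
  apply: contra pq => /eqP/matrixP WE; apply/eqP/Winj/matrixP => i j.
  by have := WE i j; rewrite !mxE => -[].
have := det_midpoint_lt pf qf WN.
have -> : 2^-1 *: (cplxmx (W p) + cplxmx (W q)) = cplxmx (W m).
  by rewrite Wm /cplxmx map_mxZ map_mxD fmorphV rmorph_nat.
rewrite !det_cplxmx -rmorphM -rmorphXn ltcR dE -expr2 => lt_sq.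
have ms : simplex R n m.
  split=> [|i]; last by rewrite !mxE addr_ge0// mulr_ge0// invr_ge0.
  under eq_bigr do rewrite !mxE.
  by rewrite big_split/= -!mulr_sumr p1 q1 [RHS]splitr !mulr1 mul1r.
have dm0 : 0 < \det (W m).
  (* Its square exceeds a square; as [W m] is positive semidefinite, it is then definite and [m] is
     feasible. *)
  have dmne : \det (W m) != 0.
    by apply: contraTneq lt_sq => ->; rewrite expr0n/= ltNge sqr_ge0.
  apply: feasible_det_gt0; apply: psd_det_posdefmx dmne.
    exact: gramian_sym.
  by move=> x; apply: gramian_psd; case: ms.
have := qmin m (conj (simplex_det_feasible ms dm0) ms).
rewrite /vcs_objective lerN2 ler_ln ?posrE// leNgt => /negP; apply.
by rewrite -(ltr_pXn2r (n := 2)) ?nnegrE// ltW.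
Qed.

End Optimization.

Lemma minimizer_shift (R : realType) (V : Type) (f g : V -> R) (D : set V)
    (c : R) : (forall p, D p -> g p = c + f p) ->
  minimizer g D = minimizer f D.
Proof.
move=> gE; apply/seteqP; split=> p [Dp pmin]; split=> // q Dq; move: (pmin q Dq).
  by rewrite !gE// lerD2l.
by rewrite !gE// lerD2l.
Qed.

Theorem proposition1 (R : realType) (n : nat) (n_gt0 : (0 < n)%N)
    (A : 'M[R]_n) (S : 'M[R[i]]_n) (S_unit : S \in unitmx) :
  {ae lebesgue_measure, forall T : R, 0 < T ->
     exists pvcs ptvcs : 'rV[R]_n,
       [/\ unique (minimizer (vcs_objective A T)
                     (feasible_pd A T `&` simplex R n)) pvcs,
           unique (minimizer (vcs_objective_tilde A S T)
                     (feasible_pd A T `&` simplex R n)) ptvcs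
         & ptvcs = pvcs]}.
Proof.
(* The exceptional times are among those at which injectivity of [p |-> W(p,T)] fails, a null set
   depending on [A] alone. *)
apply: negligibleS (gramian_inj_ae A) => T; apply: contra_not => Winj T_gt0.
have [p p_min] := vcs_minimizer_exists A n_gt0 T_gt0.
have [d d_gt0 detE] := det_gramian_tilde A T S_unit.
have tildeE q : (feasible_pd A T `&` simplex R n) q ->
    vcs_objective_tilde A S T q = - ln d + vcs_objective A T q.
  move=> [/feasible_det_gt0 q_det [_ q_ge0]].
  by rewrite /vcs_objective_tilde detE// lnM ?posrE// opprD.
have p_unique : unique (minimizer (vcs_objective A T)
    (feasible_pd A T `&` simplex R n)) p.
  by split=> // q; exact: vcs_minimizer_unique (Winj T_gt0) p_min.
exists p, p; split; [exact: p_unique| |reflexivity].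
by rewrite (minimizer_shift tildeE); exact: p_unique.
Qed.
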